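(* Let $\mathbb{H}$ be the quaternions, regarded as a real operator system, and let $\varphi:\mathbb{H}\to\mathbb{R}$ be its unique state (the coefficient of $1$). On the operator system dual $(\mathbb{H}^d,\varphi)$, the order unit norm on $\mathbb{H}^d$ induced by the order unit $\varphi$ coincides with the Banach space dual norm (that is, the usual norm of $\mathbb{H}^*=B(\mathbb{H},\mathbb{R})$). Also, $(\mathbb{H}^d,\varphi)$ is unitally isometrically completely order isomorphic to $(\mathbb{H},1)$.
   Context: A real operator system is a unital selfadjoint real subspace of $B(H)$, $H$ a real Hilbert space, with its matrix cones; $\mathbb{H}$ is viewed as a real C$^*$-algebra (a real $*$-subalgebra of $M_4(\mathbb{R})$, or of $M_2(\mathbb{C})$). A state is a unital selfadjoint positive real functional. The operator system dual $(\mathbb{H}^d,\varphi)$ is the real dual space with involution $\psi^*(x)=\psi(x^* )$, unit $\varphi$ and matrix cones $M_n(\mathbb{H}^d)^+=\{[\psi_{ij}]: x\mapsto[\psi_{ij}(x)]\text{ is completely positive from }\mathbb{H}\text{ to }M_n(\mathbb{R})\}$; this is an (abstract) real operator system. The order unit norm in a real operator system $V$ with unit $e$ is $\|x\|=\inf\{t>0:\begin{bmatrix} te & x \\ {x^*} & te \end{bmatrix}\in M_2(V)^+\}$. A complete order isomorphism is a selfadjoint linear bijection which is completely positive with completely positive inverse; it is unital if it maps the unit to the unit. *)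

(* Defs.v *)
From HB Require Import structures.
From mathcomp Require Import all_boot all_order all_algebra.
From mathcomp Require Import ring.
From mathcomp Require Import all_classical all_reals.

Set Implicit Arguments.
Unset Strict Implicit.
Unset Printing Implicit Defensive.

Import Order.TTheory GRing.Theory Num.Theory.

Local Open Scope classical_set_scope.
Local Open Scope ring_scope.

(* The data of a (finite-dimensional) abstract real operator system: a real
   *-vector space with a unit and a cone in each M_n(V).  The axioms (proper
   compatible cones, Archimedean matrix order unit) are not bundled: the notions
   below depend on the data only. *)
Record opsys (R : realType) := OpSys {
  os_sort :> vectType R;
  os_star : {linear os_sort -> os_sort};
  os_unit : os_sort;
  os_pos : forall n, set 'M[os_sort]_n
}.
Arguments os_star {R} V : rename.
Arguments os_unit {R} V : rename.
Arguments os_pos {R} V n : rename.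

Section OperatorSystems.
Variable R : realType.

(* In the real case symmetry does not follow from nonnegativity of the quadratic
   form, and has to be required. *)
Definition psdmx n (M : 'M[R]_n) : Prop :=
  M^T = M /\ forall v : 'rV[R]_n, 0 <= (v *m M *m v^T) 0 0.

(* The cone of M_n(V) inherited, through a representation rho : V -> M_N(R), from
   M_n(M_N(R)) = M_{nN}(R) = B(R^{nN}). *)
Definition concrete_pos (V : Type) N (rho : V -> 'M[R]_N) n : set 'M[V]_n :=
  [set A | psdmx (\mxblock_(i < n, j < n) rho (A i j))].

Definition os_mx n : opsys R :=
  @OpSys R 'M[R]_n trmx 1%:M (concrete_pos id).

Definition cp_map (V W : opsys R) (u : V -> W) : Prop :=
  forall n (A : 'M[V]_n), os_pos V n A -> os_pos W n (map_mx u A).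

Definition is_state (V : opsys R) (phi : 'Hom(V, R^o)) : Prop :=
  [/\ phi (os_unit V) = 1,
      forall x : V, phi (os_star V x) = phi x
    & forall x : V, os_pos V 1 (const_mx x) -> 0 <= phi x].

Definition ou_norm (V : opsys R) (x : V) : R :=
  inf [set t : R | 0 < t /\
    os_pos V (1 + 1)
      (block_mx (const_mx (t *: os_unit V)) (const_mx x)
                (const_mx (os_star V x)) (const_mx (t *: os_unit V)))].

(* The inverse g is automatically linear and selfadjoint. *)
Definition unital_coiso (V W : opsys R) (f : 'Hom(V, W)) : Prop :=
  [/\ f (os_unit V) = os_unit W,
      forall x : V, f (os_star V x) = os_star W (f x),
      cp_map f
    & exists g : W -> V, [/\ cancel f g, cancel g f & cp_map g]].

Definition dual_star (V : opsys R) (psi : 'Hom(V, R^o)) : 'Hom(V, R^o) :=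
  (psi \o linfun (os_star V))%VF.

Fact dual_star_is_linear (V : opsys R) : linear (@dual_star V).
Proof. by move=> a f g; rewrite /dual_star comp_lfunDl comp_lfunZl. Qed.

HB.instance Definition _ (V : opsys R) :=
  GRing.isLinear.Build R 'Hom(V, R^o) 'Hom(V, R^o) _ (@dual_star V)
    (@dual_star_is_linear V).

Lemma dual_starE (V : opsys R) (psi : 'Hom(V, R^o)) (x : V) :
  dual_star psi x = psi (os_star V x).
Proof. by rewrite comp_lfunE lfunE. Qed.

Definition dual_pos (V : opsys R) n : set 'M['Hom(V, R^o)]_n :=
  [set Psi : 'M['Hom(V, R^o)]_n | @cp_map V (os_mx n) (fun x => \matrix_(i, j) Psi i j x)].

Definition os_dual (V : opsys R) (phi : 'Hom(V, R^o)) : opsys R :=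
  @OpSys R 'Hom(V, R^o) (@dual_star V) phi (@dual_pos V).

End OperatorSystems.

(* The quaternion a + b i + c j + d k is the row vector (a, b, c, d). *)
Definition quat (R : realType) : Type := 'rV[R]_4.

Section Quaternions.
Variable R : realType.
Local Notation quat := (quat R).

HB.instance Definition _ := Vector.on quat.

Definition mkquat (a b c d : R) : quat := \row_(k < 4) [:: a; b; c; d]`_k.

Definition qone : quat := mkquat 1 0 0 0.

Definition qmul (p q : quat) : quat := mkquat
  (p 0 0 * q 0 0 - p 0 1 * q 0 1 - p 0 2 * q 0 2 - p 0 3 * q 0 3)
  (p 0 0 * q 0 1 + p 0 1 * q 0 0 + p 0 2 * q 0 3 - p 0 3 * q 0 2)
  (p 0 0 * q 0 2 - p 0 1 * q 0 3 + p 0 2 * q 0 0 + p 0 3 * q 0 1)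
  (p 0 0 * q 0 3 + p 0 1 * q 0 2 - p 0 2 * q 0 1 + p 0 3 * q 0 0).

Definition qconj (q : quat) : quat :=
  mkquat (q 0 0) (- q 0 1) (- q 0 2) (- q 0 3).

Lemma mkquatE a b c d : (mkquat a b c d 0 0 = a) * (mkquat a b c d 0 1 = b) *
  (mkquat a b c d 0 2 = c) * (mkquat a b c d 0 3 = d).
Proof. by rewrite !mxE. Qed.

Lemma quatP (p q : quat) : p 0 0 = q 0 0 -> p 0 1 = q 0 1 ->
  p 0 2 = q 0 2 -> p 0 3 = q 0 3 -> p = q.
Proof.
move=> h0 h1 h2 h3; apply/rowP => k.
case: k => [[|[|[|[|//]]]] hk].
- by rewrite (_ : Ordinal hk = 0) //; apply: val_inj.
- by rewrite (_ : Ordinal hk = 1) //; apply: val_inj.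
- by rewrite (_ : Ordinal hk = 2) //; apply: val_inj.
- by rewrite (_ : Ordinal hk = 3) //; apply: val_inj.
Qed.

Fact qmulA : associative qmul.
Proof. by move=> p q r; apply: quatP; rewrite !mkquatE; ring. Qed.
Fact qmul1l : left_id qone qmul.
Proof. by move=> p; apply: quatP; rewrite !mkquatE; ring. Qed.
Fact qmul1r : right_id qone qmul.
Proof. by move=> p; apply: quatP; rewrite !mkquatE; ring. Qed.
Fact qmulDl : left_distributive qmul +%R.
Proof. by move=> p q r; apply: quatP; rewrite !(mkquatE, mxE) /=; ring. Qed.
Fact qmulDr : right_distributive qmul +%R.
Proof. by move=> p q r; apply: quatP; rewrite !(mkquatE, mxE) /=; ring. Qed.
Fact qone_neq0 : qone != 0.
Proof.
by apply/eqP => /rowP/(_ 0); rewrite mkquatE mxE => /eqP; rewrite oner_eq0.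
Qed.

HB.instance Definition _ := GRing.Zmodule_isNzRing.Build quat
  qmulA qmul1l qmul1r qmulDl qmulDr qone_neq0.

Fact qconj_is_linear : linear qconj.
Proof. by move=> a p q; apply: quatP; rewrite !(mkquatE, mxE) /=; ring. Qed.

HB.instance Definition _ :=
  GRing.isLinear.Build R quat quat _ qconj qconj_is_linear.

(* The embedding of the quaternions in M_4(R) = B(R^4) by left multiplication,
   acting on columns; the lemmas below show that it is a unital *-homomorphism. *)
Definition qmx (q : quat) : 'M[R]_4 := (lin1_mx (fun x : quat => q * x))^T.

Lemma mul_qmx (q x : quat) : qmx q *m x^T = (q * x)^T.
Proof.
have lin_q : linear (fun y : quat => q * y).
  by move=> a y z; apply: quatP; rewrite !(mkquatE, mxE) /=; ring.
pose f := HB.pack_for {linear 'rV[R]_4 -> 'rV[R]_4} (fun y : quat => q * y)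
  (GRing.isLinear.Build R 'rV[R]_4 'rV[R]_4 _ _ lin_q).
by rewrite /qmx -trmx_mul (mul_rV_lin1 f).
Qed.

Lemma mx4_ext (M N : 'M[R]_4) :
  (forall x : quat, M *m x^T = N *m x^T) -> M = N.
Proof.
move=> eqMN; apply: trmx_inj; apply/row_matrixP => i.
by rewrite !rowE; apply: trmx_inj; rewrite !trmx_mul !trmxK.
Qed.

Lemma qmx1 : qmx 1 = 1%:M.
Proof. by apply: mx4_ext => x; rewrite mul_qmx mul1r mul1mx. Qed.

Lemma qmxM p q : qmx (p * q) = qmx p *m qmx q.
Proof. by apply: mx4_ext => x; rewrite -mulmxA !mul_qmx mulrA. Qed.

Lemma qmx_linear a p q : qmx (a *: p + q) = a *: qmx p + qmx q.
Proof.
apply: mx4_ext => x; rewrite mulmxDl -scalemxAl !mul_qmx -linearZ -linearD.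
by congr (_^T); apply: quatP; rewrite !(mkquatE, mxE) /=; ring.
Qed.

Lemma qmx_conj q : qmx (qconj q) = (qmx q)^T.
Proof.
apply/matrixP => -[[|[|[|[|//]]]] hi] -[[|[|[|[|//]]]] hj];
  by rewrite !mxE /=; ring.
Qed.

Definition os_quat : opsys R := @OpSys R quat qconj 1 (concrete_pos qmx).

Definition qphi : 'Hom(os_quat, R^o) := linfun (fun q : quat => q 0 0 : R^o).

Lemma qphiE (q : quat) : qphi q = q 0 0.
Proof.
have lin_re : linear (fun q : quat => q 0 0 : R^o) by move=> a p r; rewrite !mxE.
pose f := HB.pack_for {linear quat -> R^o} (fun q : quat => q 0 0 : R^o)
  (GRing.isLinear.Build R quat R^o _ _ lin_re).
exact: (lfunE f).
Qed.

(* By qnormM this is also the operator norm of qmx q on Euclidean R^4. *)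
Definition qnorm (q : quat) : R := Num.sqrt (\sum_(k < 4) q 0 k ^+ 2).

Lemma qnormM (p q : quat) : qnorm (p * q) = qnorm p * qnorm q.
Proof.
have sum4 (x : quat) : \sum_(k < 4) x 0 k ^+ 2 =
    x 0 0 ^+ 2 + x 0 1 ^+ 2 + x 0 2 ^+ 2 + x 0 3 ^+ 2.
  rewrite !big_ord_recr big_ord0 /= add0r.
  by congr (_ + _ + _ + _); congr (x _ _ ^+ 2); apply: val_inj.
rewrite /qnorm -sqrtrM; last by apply: sumr_ge0 => k _; exact: sqr_ge0.
by congr Num.sqrt; rewrite !sum4 !mkquatE; ring.
Qed.

Definition qdual_norm (psi : 'Hom(os_quat, R^o)) : R :=
  sup [set `|psi q : R| | q in [set q : quat | qnorm q <= 1]].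

End Quaternions.

Arguments os_quat {R}.
Arguments qphi {R}.

(* Main.v *)
(* Every functional on the quaternions is [x |-> <a, x>] for a unique quaternion
   [a], with the Euclidean inner product; the isomorphism sends it to [a].  If
   the block matrix [a_ij] is positive, a Gram decomposition of its real
   representation exhibits [4 <a_ij, x_kl> = tr (qmx a_ij ^T qmx x_kl)] as a sum
   of compressions of [x_kl], whence complete positivity.  Conversely, applying
   [<a_ij, .>] to the positive matrix with entries [e_k e_l^*] returns the
   quadratic form of [a_ij].  The two norms are then computed on [a]: both are
   equal to its Euclidean length. *)
From HB Require Import structures.
Require Import Defs.
From mathcomp Require Import all_boot all_order all_algebra.
From mathcomp Require Import ring lra.
From mathcomp Require Import all_classical all_reals.
Import Order.TTheory GRing.Theory Num.Theory.
Set Implicit Arguments.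
Unset Strict Implicit.
Unset Printing Implicit Defensive.
Local Open Scope ring_scope.

(** * Gram decompositions of real positive semidefinite matrices *)

Section Gram.
Variable R : realType.

Lemma mxquad_sum n (M : 'M[R]_n) (u v : 'rV[R]_n) :
  (u *m M *m v^T) 0 0 = \sum_i \sum_j u 0 i * M i j * v 0 j.
Proof.
rewrite mxE exchange_big; apply: eq_bigr => j _; rewrite !mxE mulr_suml.
by [].
Qed.

(** If [M i i] vanished, the form on the span of the basis vectors [i] and [j], with [M i j]
    nonzero, would be affine and nonconstant along a line, hence negative somewhere. *)
Lemma psdmx_pivot n (M : 'M[R]_n) i :
  psdmx M -> row i M != 0 -> 0 < M i i.
Proof.
move=> [Msym Mpos] /rV0Pn [j]; rewrite mxE => Mij0.
have Mji : M j i = M i j by rewrite -[in LHS]Msym mxE.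
have quad (u : 'rV[R]_n) : 0 <= (u *m M *m u^T) 0 0 by exact: Mpos.
have form (x y : R) : 0 <= x ^+ 2 * M i i + 2 * x * y * M i j + y ^+ 2 * M j j.
  have := quad (x *: delta_mx 0 i + y *: delta_mx 0 j).
  rewrite linearD /= !linearZ /= !trmx_delta !(mulmxDl, mulmxDr).
  rewrite -!(scalemxAl, scalemxAr) -!rowE.
  rewrite -!colE !mxE Mji; congr (_ <= _); ring.
rewrite lt_neqAle; apply/andP; split; last by have := form 1 0; nra.
apply/eqP => Mii0.
(* With [M i i = 0] and [y = 1], this value of [x] makes the form equal to -1. *)
have := form (- (M j j + 1) / (2 * M i j)) 1; rewrite -Mii0.
have -> : 2 * (- (M j j + 1) / (2 * M i j)) * 1 * M i j = - (M j j + 1).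
  by field.
lra.
Qed.

Lemma psdmx_schur n (M : 'M[R]_n) i :
  psdmx M -> row i M != 0 ->
  psdmx (M - (M i i)^-1 *: ((row i M)^T *m row i M)).
Proof.
move=> psdM ri0; have Mii := psdmx_pivot psdM ri0; case: psdM => Msym Mpos.
split.
  by rewrite linearB linearZ /= trmx_mul trmxK Msym.
move=> v; set a := (row i M *m v^T) 0 0.
have ra : row i M *m v^T = a%:M.
  by apply/matrixP => p q; rewrite !ord1 !mxE eqxx mulr1n /a !mxE.
have va : v *m (row i M)^T = a%:M.
  by rewrite -[LHS]trmxK trmx_mul trmxK ra tr_scalar_mx.
(* Completing the square: among the vectors [v - c e_i] the form is least at [c = a / M i i], and
   its value there is that of the Schur complement at [v]. *)
have := Mpos (v - (a / M i i) *: delta_mx 0 i).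
have -> : (v - (a / M i i) *: delta_mx 0 i)^T =
    v^T - (a / M i i) *: delta_mx i 0.
  by rewrite linearB /= linearZ /= trmx_delta.
rewrite !(mulmxBl, mulmxBr) -!(scalemxAl, scalemxAr) -!rowE.
have -> : v *m M *m delta_mx i 0 = a%:M.
  by rewrite -mulmxA -colE -[col i M]trmxK tr_col Msym va.
rewrite mulmxA va -[a%:M *m _ *m _]mulmxA ra -colE mul_scalar_mx !mxE /=.
rewrite !mulr1n; congr (_ <= _); field.
by rewrite gt_eqF.
Qed.

(** Cholesky elimination, by induction on the number of nonzero rows: each nonzero row splits off a
    rank-one term and leaves its Schur complement. *)
Lemma psdmx_gram n (M : 'M[R]_n) :
  psdmx M -> exists gs : seq 'rV[R]_n, M = \sum_(g <- gs) g^T *m g.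
Proof.
have [m] := ubnP #|[set i | row i M != 0]|.
elim: m M => // m IHm M leM psdM.
have [/existsP[i ri0]|/existsPn rows0] := boolP [exists i, row i M != 0];
  last first.
  exists [::]; rewrite big_nil; apply/row_matrixP => i.
  by rewrite row0; apply/eqP/negPn/rows0.
have Mii := psdmx_pivot psdM ri0; have psdN := psdmx_schur psdM ri0.
set N := M - _ in psdN.
have rowN j : row j N = row j M - ((M i i)^-1 * M i j) *: row i M.
  apply/rowP => k; rewrite !mxE big_ord1 !mxE; ring.
have [|gs defN] := IHm N _ psdN.
  (* Elimination clears row [i]. A zero row [j] stays zero, since symmetry gives [M i j = 0]. So the
     count of nonzero rows drops. *)
  apply: leq_trans (leM : (_ <= m)%N); apply: proper_card; apply/properP; split.
    apply/fintype.subsetP => j; rewrite !inE; apply: contraNN => /eqP rj0.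
    rewrite rowN rj0 (_ : M i j = 0) ?mulr0 ?scale0r ?subr0 //.
    by rewrite -[M]psdM.1 mxE; have /rowP/(_ i) := rj0; rewrite !mxE.
  exists i; rewrite !inE //.
  by rewrite rowN mulVf ?gt_eqF // scale1r subrr eqxx.
exists ((Num.sqrt (M i i))^-1 *: row i M :: gs).
rewrite big_cons -defN !linearZ /= -scalemxAl scalerA -invfM.
by rewrite -expr2 sqr_sqrtr ?ltW // addrC subrK.
Qed.

Lemma concrete_posP (V : Type) N (rho : V -> 'M[R]_N) n (A : 'M[V]_n) :
  concrete_pos rho A <->
  (forall i j, rho (A j i) = (rho (A i j))^T) /\
  forall v : 'I_n -> 'rV[R]_N,
    0 <= \sum_i \sum_j (v i *m rho (A i j) *m (v j)^T) 0 0.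
Proof.
have form (v : 'I_n -> 'rV[R]_N) :
    (\mxrow_i v i *m \mxblock_(i < n, j < n) rho (A i j)
       *m (\mxrow_i v i)^T) 0 0 =
    \sum_i \sum_j (v i *m rho (A i j) *m (v j)^T) 0 0.
  rewrite mul_mxrow_mxblock tr_mxrow mul_mxrow_mxcol summxE exchange_big /=.
  by apply: eq_bigr => j _; rewrite mulmx_suml summxE.
have sym : (\mxblock_(i < n, j < n) rho (A i j))^T =
      \mxblock_(i < n, j < n) rho (A i j) <->
    forall i j, rho (A j i) = (rho (A i j))^T.
  by rewrite tr_mxblock -eq_mxblockP; split=> eqA i j; exact: esym (eqA _ _).
split=> -[/sym Asym Apos]; split=> // v; first by rewrite -form; apply: Apos.
by rewrite -[v]submxrowK form.
Qed.

(** Each Gram vector of the large block matrix is cut into [n] pieces of length [N]. *)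
Lemma concrete_pos_gram (V : Type) N (rho : V -> 'M[R]_N) n (A : 'M[V]_n) :
  concrete_pos rho A ->
  exists Gs : seq ('I_n -> 'rV[R]_N),
    forall i j, rho (A i j) = \sum_(G <- Gs) (G i)^T *m G j.
Proof.
move=> /psdmx_gram[gs defA].
exists [seq (fun i => submxrow g i) | g <- gs] => i j.
rewrite -(mxblockK (fun i j => rho (A i j))) defA big_map.
apply/matrixP => s t; rewrite mxE !summxE; apply: eq_bigr => g _.
by rewrite !mxE; apply: eq_bigr => k _; rewrite !mxE.
Qed.
End Gram.

(** * The Euclidean inner product on the quaternions and their matrix cones *)

Section QuatDual.
Variable R : realType.
Local Notation quat := (quat R).
Local Notation functional := 'Hom(@os_quat R, R^o).

Lemma sum4 (F : 'I_4 -> R) : \sum_k F k = F 0 + F 1 + F 2 + F 3.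
Proof.
rewrite !big_ord_recr big_ord0 /= add0r.
by congr (_ + _ + _ + _); congr F; apply: val_inj.
Qed.

Definition qdot (p q : quat) : R := (p *m q^T) 0 0.

Lemma qdotE p q :
  qdot p q = p 0 0 * q 0 0 + p 0 1 * q 0 1 + p 0 2 * q 0 2 + p 0 3 * q 0 3.
Proof. by rewrite /qdot mxE sum4 !mxE. Qed.

Lemma qdot_qmx p q x : (p *m qmx q *m x^T) 0 0 = qdot p (q * x).
Proof. by rewrite -mulmxA mul_qmx. Qed.

Lemma qdot_conj p q : qdot (qconj p) (qconj q) = qdot p q.
Proof. by rewrite !qdotE !mkquatE; ring. Qed.

(** Right multiplications by [v] and by [qconj v] are adjoint to each other. *)
Lemma qdot_mul (a u v : quat) : qdot a (u * qconj v) = qdot u (a * v).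
Proof. by rewrite !qdotE !mkquatE; ring. Qed.

Lemma qconjM (p q : quat) : qconj (p * q) = qconj q * qconj p.
Proof. by apply: quatP; rewrite !mkquatE; ring. Qed.

Lemma qconjK : involutive (@qconj R).
Proof. by move=> p; apply: quatP; rewrite !mkquatE ?opprK. Qed.

(** The product is [qmx (qconj a * x)], whose four diagonal entries all equal the real part of
    [qconj a * x], which is [qdot a x]. *)
Lemma mxtrace_qmx (a x : quat) :
  \tr ((qmx a)^T *m qmx x) = 4 * qdot a x.
Proof.
rewrite -qmx_conj -qmxM /mxtrace sum4 !mxE !eqxx /=.
by rewrite qdotE; ring.
Qed.

Lemma qmx_inj : injective (@qmx R).
Proof.
move=> p q eq_pq; have := mul_qmx p 1; rewrite eq_pq mul_qmx !mulr1.
by move/trmx_inj.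
Qed.

Lemma qconcrete_posP n (A : 'M[quat]_n) :
  concrete_pos (@qmx R) A <->
  (forall i j, A j i = qconj (A i j)) /\
  forall x : 'I_n -> quat, 0 <= \sum_i \sum_j qdot (x i) (A i j * x j).
Proof.
rewrite concrete_posP; split=> -[Asym Apos]; split.
- by move=> i j; apply: qmx_inj; rewrite qmx_conj.
- move=> x; have := Apos x; congr (_ <= _).
  by apply: eq_bigr => i _; apply: eq_bigr => j _; rewrite qdot_qmx.
- by move=> i j; rewrite Asym qmx_conj.
- move=> x; have := Apos x; congr (_ <= _).
  by apply: eq_bigr => i _; apply: eq_bigr => j _; rewrite qdot_qmx.
Qed.

(** * Riesz vectors of functionals, and the matrix cones of the dual *)

Definition qvec (psi : functional) : quat := \row_k psi (delta_mx 0 k : quat).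

Lemma qvecE (psi : functional) (x : quat) : psi x = qdot (qvec psi) x.
Proof.
rewrite [x in LHS]row_sum_delta linear_sum /qdot mxE.
apply: eq_bigr => k _; rewrite !mxE linearZ /= mulrC.
by [].
Qed.


Lemma comb_form N n (Q : 'M[R]_N) (G : 'I_n -> 'rV[R]_N) (u w : 'rV[R]_n) :
  ((\sum_i u 0 i *: G i) *m Q *m (\sum_j w 0 j *: G j)^T) 0 0 =
  \sum_i \sum_j u 0 i * (G i *m Q *m (G j)^T) 0 0 * w 0 j.
Proof.
rewrite !mulmx_suml summxE; apply: eq_bigr => i _.
rewrite linear_sum mulmx_sumr summxE; apply: eq_bigr => j _.
by rewrite linearZ /= -!scalemxAl -scalemxAr !mxE; ring.
Qed.

Lemma dual_pos_concrete n (Psi : 'M[functional]_n) :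
  concrete_pos (@qmx R) (map_mx qvec Psi) -> dual_pos (V := os_quat) Psi.
Proof.
move=> psdA m X psdX.
have [Gs defA] := concrete_pos_gram psdA.
move: psdA => /qconcrete_posP[Asym _].
have [/= Xsym _] := (qconcrete_posP X).1 psdX.
move: psdX => /concrete_posP[_ Xpos].
apply/concrete_posP; split=> [k l|v].
  apply/matrixP => i j; rewrite !mxE !qvecE.
  have := Asym j i; have := Xsym k l; rewrite !mxE => -> ->.
  exact: qdot_conj.
(* The image form at [v], times the 4 of [mxtrace_qmx], is the sum over the Gram families [G] of the
   forms of [X] at the vectors [y G k]. *)
pose y (G : 'I_n -> quat) k := \sum_i v k 0 i *: G i.
rewrite -(pmulr_rge0 _ (ltr0Sn R 3)).
suff -> : 4 * (\sum_k \sum_l (v k *m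
      map_mx (fun x : quat => \matrix_(i, j) Psi i j x) X k l
      *m (v l)^T) 0 0) =
    \sum_(G <- Gs) \sum_k \sum_l (y G k *m qmx (X k l) *m (y G l)^T) 0 0.
  by apply: sumr_ge0 => G _; apply: Xpos.
rewrite [RHS]exchange_big mulr_sumr; apply: eq_bigr => k _ /=.
rewrite [RHS]exchange_big mulr_sumr; apply: eq_bigr => l _ /=.
under [RHS]eq_bigr do rewrite comb_form.
rewrite mxquad_sum [RHS]exchange_big mulr_sumr; apply: eq_bigr => i _ /=.
rewrite [RHS]exchange_big mulr_sumr; apply: eq_bigr => j _ /=.
rewrite -mulr_suml -mulr_sumr !mxE qvecE mulrA [4 * _]mulrCA -mxtrace_qmx.
congr (_ * _ * _).
have := defA i j; rewrite mxE => ->.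
rewrite linear_sum mulmx_suml linear_sum; apply: eq_bigr => G _ /=.
(* Cyclicity of the trace turns each Gram term into the scalar [G i *m qmx (X k l) *m (G j)^T]. *)
by rewrite trmx_mul trmxK -[in LHS]mulmxA mxtrace_mulC trace_mx11.
Qed.

Lemma qdot_mull p q r : qdot p (q * r) = qdot (qconj q * p) r.
Proof. by rewrite !qdotE !mkquatE; ring. Qed.

Lemma qdot_ge0 p : 0 <= qdot p p.
Proof. by rewrite qdotE -!expr2 !addr_ge0 ?sqr_ge0. Qed.

Lemma qdot_delta (a : quat) l : qdot a (delta_mx 0 l : quat) = a 0 l.
Proof. by rewrite /qdot trmx_delta -colE !mxE. Qed.

Lemma delta_quat1 : (delta_mx 0 0 : quat) = 1.
Proof. by apply: quatP; rewrite !mxE. Qed.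

Lemma qconj1 : qconj (1 : quat) = 1.
Proof. by rewrite -delta_quat1; apply: quatP; rewrite !mkquatE !mxE ?oppr0. Qed.

(** The form at [x] is the squared length of the sum of the [qconj (w i) * x i]. *)
Lemma qcone_gram n (w : 'I_n -> quat) :
  concrete_pos (@qmx R) (\matrix_(k, l) (w k * qconj (w l))).
Proof.
apply/qconcrete_posP; split=> [k l|x]; first by rewrite !mxE qconjM qconjK.
suff -> : \sum_i \sum_j
      qdot (x i) ((\matrix_(k, l) (w k * qconj (w l))) i j * x j) =
    qdot (\sum_i qconj (w i) * x i) (\sum_i qconj (w i) * x i).
  exact: qdot_ge0.
rewrite [in RHS]/qdot mulmx_suml summxE; apply: eq_bigr => i _.
rewrite linear_sum mulmx_sumr summxE; apply: eq_bigr => j _.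
by rewrite mxE -mulrA qdot_mull.
Qed.

Lemma concrete_dual_pos n (Psi : 'M[functional]_n) :
  dual_pos (V := os_quat) Psi -> concrete_pos (@qmx R) (map_mx qvec Psi).
Proof.
pose e k : quat := delta_mx 0 k.
move=> /(_ 4%N _ (qcone_gram e)) /concrete_posP[Psym Ppos].
apply/qconcrete_posP; split=> [i j|x].
  rewrite ![map_mx _ _ _ _]mxE; apply/rowP => l.
  (* Since [e 0] is 1, the blocks [(l, 0)] and [(0, l)] of the test matrix are [e l] and its
     conjugate. *)
  have dotP : qdot (qvec (Psi j i)) (e l) = qdot (qvec (Psi i j)) (qconj (e l)).
    have := congr1 (fun M : 'M[R]_n => M j i) (Psym 0 l).
    by rewrite !mxE !qvecE /e delta_quat1 mul1r qconj1 mulr1.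
  by rewrite -[LHS]qdot_delta dotP -qdot_conj qconjK qdot_delta.
(* The test vectors transpose the coordinates of [x]: the sums over [k] and [l] then reassemble
   [x i] and [x j]. *)
have := Ppos (fun k => \row_i x i 0 k); congr (_ <= _).
transitivity (\sum_k \sum_l \sum_i \sum_j
    x i 0 k * qdot (e k) (qvec (Psi i j) * e l) * x j 0 l).
  apply: eq_bigr => k _; apply: eq_bigr => l _; rewrite mxquad_sum.
  apply: eq_bigr => i _; apply: eq_bigr => j _; rewrite !mxE qvecE.
  by rewrite qdot_mul.
under eq_bigr do rewrite exchange_big.
rewrite exchange_big; apply: eq_bigr => i _ /=.
under eq_bigr do rewrite exchange_big.
rewrite exchange_big; apply: eq_bigr => j _ /=.
rewrite -qdot_qmx [x i]row_sum_delta [x j]row_sum_delta comb_form !mxE.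
apply: eq_bigr => k _; apply: eq_bigr => l _.
by rewrite qdot_qmx -!row_sum_delta.
Qed.


Lemma dual_posP n (Psi : 'M[functional]_n) :
  dual_pos (V := os_quat) Psi <-> concrete_pos (@qmx R) (map_mx qvec Psi).
Proof. by split; [apply: concrete_dual_pos | apply: dual_pos_concrete]. Qed.

(** * The linear bijection between functionals and quaternions, with its unit and involution *)

Fact qvec_is_linear : linear qvec.
Proof. by move=> a f g; apply/rowP => k; rewrite !mxE lfunE /= lfunE. Qed.

HB.instance Definition _ :=
  GRing.isLinear.Build R functional quat _ qvec qvec_is_linear.

Fact qdot_is_linear a : linear (qdot a : quat -> R^o).
Proof. by move=> c p q; rewrite !qdotE !mxE [c *: _]/GRing.scale /=; ring. Qed.

HB.instance Definition _ a :=
  GRing.isLinear.Build R quat R^o _ (qdot a) (qdot_is_linear a).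

Definition qfun (a : quat) : functional := linfun (qdot a : quat -> R^o).

Lemma qfunE a x : qfun a x = qdot a x.
Proof. exact: lfunE. Qed.

Lemma qvecK : cancel qvec qfun.
Proof. by move=> psi; apply/lfunP => x; rewrite qfunE qvecE. Qed.

Lemma qfunK : cancel qfun qvec.
Proof. by move=> a; apply/rowP => k; rewrite mxE qfunE qdot_delta. Qed.

Lemma qvec_phi : qvec qphi = 1.
Proof. by apply/rowP => k; rewrite mxE qphiE -delta_quat1 !mxE eq_sym. Qed.

Lemma qvec_star (psi : functional) : qvec (dual_star psi) = qconj (qvec psi).
Proof.
apply/rowP => k; rewrite -[RHS]qdot_delta -qdot_conj qconjK -qvecE mxE.
by rewrite dual_starE.
Qed.

(** * The order unit norm and the dual norm as Euclidean length *)

Lemma qnorm_sqr a : qnorm a ^+ 2 = qdot a a.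
Proof.
rewrite sqr_sqrtr ?sumr_ge0 // => [|k _]; last exact: sqr_ge0.
by rewrite sum4 qdotE !expr2.
Qed.

Lemma qnorm_ge0 (a : quat) : 0 <= qnorm a.
Proof. exact: sqrtr_ge0. Qed.

Lemma qdotC p q : qdot p q = qdot q p.
Proof. by rewrite !qdotE; ring. Qed.

(* [qdot a x] is the real part of [qconj a * x]. *)
Lemma qdot_CS a x : `|qdot a x| <= qnorm a * qnorm x.
Proof.
have -> : qdot a x = (qconj a * x) 0 0 by rewrite qdotE !mkquatE; ring.
have -> : qnorm a = qnorm (qconj a).
  by rewrite /qnorm !sum4 !mkquatE !sqrrN.
rewrite -qnormM -ler_sqr ?nnegrE ?qnorm_ge0 // real_normK ?num_real //.
by rewrite qnorm_sqr qdotE -!expr2 -!addrA lerDl !addr_ge0 ?sqr_ge0.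
Qed.

(* For [qnorm a <= t] the quadratic form is [t^-1] times
   [|t x_0 + a x_1|^2 + (t^2 - |a|^2) |x_1|^2]; for the converse, test it on
   [(- a, t)]. *)
Lemma qblock_pos (a : quat) (t : R) : 0 < t ->
  concrete_pos (@qmx R) (block_mx (const_mx (t *: (1 : quat))) (const_mx a)
     (const_mx (qconj a)) (const_mx (t *: (1 : quat))) : 'M[quat]_(1 + 1)) <->
  qnorm a <= t.
Proof.
move=> t_gt0; set A := block_mx _ _ _ _.
have form (x : 'I_(1 + 1) -> quat) :
    \sum_i \sum_j qdot (x i) (A i j * x j) =
    t * qdot (x (lshift 1 0)) (x (lshift 1 0))
    + 2 * qdot (x (lshift 1 0)) (a * x (rshift 1 0))
    + t * qdot (x (rshift 1 0)) (x (rshift 1 0)).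
  rewrite big_split_ord !big_ord1 !big_split_ord !big_ord1 /=.
  rewrite block_mxEul block_mxEur block_mxEdl block_mxEdr ![const_mx _ _ _]mxE.
  rewrite [qdot _ (qconj a * _)]qdot_mull qconjK [qdot (a * _) _]qdotC.
  by rewrite !qdotE !mkquatE !mxE /=; ring.
have Asym i j : A j i = qconj (A i j).
  case: (split_ordP i) => i' ->; case: (split_ordP j) => j' ->;
  by rewrite ?(block_mxEul, block_mxEur, block_mxEdl, block_mxEdr)
    ![const_mx _ _ _]mxE ?linearZ /= ?qconj1 ?qconjK.
have -> : (qnorm a <= t) = (qdot a a <= t ^+ 2).
  by rewrite -qnorm_sqr ler_sqr ?nnegrE ?qnorm_ge0 ?(ltW t_gt0).
rewrite qconcrete_posP.
pose x (i : 'I_(1 + 1)) : quat := if val i == 0%N then - a else t *: (1 : quat).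
split=> [[_ /(_ x)]|le_at].
  rewrite form /x [val (rshift _ _) == _]/= [val (lshift _ _) == _]/=.
  set y := (X in 0 <= X).
  have -> : y = t * (t ^+ 2 - qdot a a) by rewrite /y !qdotE !mxE /=; ring.
  by rewrite pmulr_rge0 // subr_ge0.
split=> // z; rewrite form; set p := z _; set q := z _.
rewrite -(pmulr_rge0 _ t_gt0).
set S := (X in 0 <= t * X).
have -> : t * S = qdot (t *: p + a * q) (t *: p + a * q) +
    (t ^+ 2 - qdot a a) * qdot q q.
  by rewrite /S !qdotE !mxE /=; ring.
by rewrite addr_ge0 ?mulr_ge0 ?qdot_ge0 // subr_ge0.
Qed.

Lemma ou_norm_qvec (psi : os_dual (@qphi R)) : ou_norm psi = qnorm (qvec psi).
Proof.
rewrite /ou_norm; set E := (X in inf X).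
have memE t : E t <-> 0 < t /\ qnorm (qvec psi) <= t.
  split=> -[t_gt0 Et]; split=> //.
    move/dual_posP: Et; rewrite map_block_mx !map_const_mx linearZ /=.
    by rewrite qvec_phi qvec_star => /qblock_pos; apply.
  apply/dual_posP; rewrite map_block_mx !map_const_mx linearZ /=.
  by rewrite qvec_phi qvec_star; apply/qblock_pos.
have lbE : lbound E (qnorm (qvec psi)) by move=> t /memE[].
(* The infimum is only approached from above: for the zero functional it is 0, which [E]
   excludes. *)
have memD e : 0 < e -> E (qnorm (qvec psi) + e).
  by move=> e_gt0; apply/memE; rewrite lerDl ltW // ltr_wpDl ?qnorm_ge0.
apply/eqP; rewrite eq_le; apply/andP; split; last first.
  by apply: lb_le_inf lbE; exists (qnorm (qvec psi) + 1); apply: memD.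
apply/ler_addgt0Pr => e e_gt0; apply: ge_inf.
  by exists (qnorm (qvec psi)).
exact: memD.
Qed.

Lemma qdual_norm_qvec (psi : functional) : qdual_norm psi = qnorm (qvec psi).
Proof.
set a := qvec psi; rewrite /qdual_norm; set E := (X in sup X).
have ubE : ubound E (qnorm a).
  move=> _ [q /= q1 <-]; rewrite qvecE; apply: le_trans (qdot_CS _ _) _.
  by rewrite ler_piMr ?qnorm_ge0.
(* Equality in Cauchy-Schwarz is reached at [a] divided by its length, or at [a] itself when that
   length is 0. *)
have aE : E (qnorm a).
  have dotZ c : qdot a (c *: a) = c * qnorm a ^+ 2.
    by rewrite linearZ /= -qnorm_sqr.
  have [a0|a_neq0] := eqVneq (qnorm a) 0.
    exists a; first by rewrite /= a0.
    by rewrite qvecE -/a -qnorm_sqr a0 expr0n normr0.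
  exists ((qnorm a)^-1 *: a) => /=.
    rewrite -(@expr_le1 _ 2) ?qnorm_ge0 // qnorm_sqr.
    have -> : qdot ((qnorm a)^-1 *: a) ((qnorm a)^-1 *: a) =
        ((qnorm a)^-1 * qnorm a) ^+ 2.
      by rewrite [RHS]exprMn qnorm_sqr !qdotE !mxE; ring.
    by rewrite mulVf // expr1n.
  by rewrite qvecE -/a dotZ expr2 mulKf // ger0_norm ?qnorm_ge0 //.
apply/eqP; rewrite eq_le; apply/andP; split.
  by apply: ge_sup ubE; exists (qnorm a).
by apply: ub_le_sup aE; exists (qnorm a).
Qed.

(** * States of the quaternions *)

Lemma qphi_state : is_state (V := os_quat) (@qphi R).
Proof.
split=> [|x|x /qconcrete_posP[_ /(_ (fun=> 1))]]; rewrite !qphiE /=.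
- by rewrite mkquatE.
- by rewrite mkquatE.
- by rewrite !big_ord1 mxE mulr1 qdotE !mkquatE !mul1r !mul0r !addr0.
Qed.

(** Selfadjointness makes the Riesz vector equal to its conjugate, so its imaginary part vanishes;
    unitality makes its real part 1. *)
Lemma state_qphi (psi : functional) : is_state psi -> psi = qphi.
Proof.
move=> [psi1 psi_star _]; rewrite -[psi]qvecK -[qphi]qvecK qvec_phi; congr qfun.
have a_conj : qconj (qvec psi) = qvec psi.
  rewrite -qvec_star; congr qvec.
  by apply/lfunP => x; rewrite dual_starE psi_star.
have a0 : qvec psi 0 0 = 1 by rewrite mxE delta_quat1.
have im0 k : - qvec psi 0 k = qvec psi 0 k -> qvec psi 0 k = 0 by lra.
by apply: quatP; rewrite !mkquatE //; apply: im0;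
  rewrite -[in RHS]a_conj mkquatE.
Qed.

End QuatDual.

Theorem proposition8p2 (R : realType) :
  (* qphi is the unique state of the quaternions *)
  (is_state (V := os_quat) (@qphi R) /\
   forall psi : 'Hom(@os_quat R, R^o), is_state psi -> psi = qphi) /\
  (* the order unit norm of the dual is the dual norm *)
  (forall psi : os_dual (@qphi R), ou_norm psi = qdual_norm psi) /\
  (* the dual is unitally isometrically completely order isomorphic to H *)
  (exists theta : 'Hom(os_dual (@qphi R), @os_quat R),
     unital_coiso theta /\
     forall psi : os_dual (@qphi R), qnorm (theta psi) = ou_norm psi).
Proof.
split; first by split; [exact: qphi_state | exact: state_qphi].
split=> [psi|]; first by rewrite ou_norm_qvec qdual_norm_qvec.
(* Complete positivity of [theta] and of its inverse [qfun] are the two implications of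
   [dual_posP]. *)
pose theta : 'Hom(os_dual (@qphi R), @os_quat R) := linfun (@qvec R).
have thetaE psi : theta psi = qvec psi by exact: lfunE.
exists theta; split=> [|psi]; last by rewrite thetaE ou_norm_qvec.
split.
- by rewrite thetaE qvec_phi.
- by move=> psi; rewrite !thetaE qvec_star.
- move=> n Psi /dual_posP; rewrite /=.
  by rewrite (_ : map_mx theta Psi = map_mx (@qvec R) Psi) //; apply: eq_map_mx.
- exists (@qfun R); split.
  + by move=> psi; rewrite thetaE qvecK.
  + by move=> a; rewrite thetaE qfunK.
  + move=> n A posA; apply/dual_posP; rewrite -map_mx_comp.
    by rewrite (eq_map_mx _ (@qfunK R)) map_mx_id.
Qed.
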